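(* Let $n\in\mathbb N$, $w>0$, $\overrightarrow{P}=(p_1,\dots,p_n)$ with $1\le p_1\le\cdots\le p_n<\infty$, and let $\chi$ be a kernel. For $f\in\Delta^{\overrightarrow P}(\mathbb R^n)$ define the generalized sampling operator $S_w(f)(\mathbf x)=\sum_{\mathbf k\in\mathbb Z^n}f\big(\tfrac{\mathbf k}{w}\big)\chi(w\mathbf x-\mathbf k)$, $\mathbf x\in\mathbb R^n$. Then $S_w$ maps $\Delta^{\overrightarrow P}(\mathbb R^n)$ into $L^{\overrightarrow P}(\mathbb R^n)$ and $$\|S_wf\|_{\overrightarrow P}\le (m_0(\chi))^{1-\frac1{p_n}}\,\|\chi\|_1^{\frac1{p_n}}\,\Big\|\Big(f\big(\tfrac{\mathbf k}{w}\big)\Big)_{\mathbf k\in\mathbb Z^n}\Big\|_{\ell^{\overrightarrow P}_w}.$$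
   Context: A kernel is a function $\chi:\mathbb R^n\to\mathbb R$ with $\chi\in L^1(\mathbb R^n)$, bounded in a neighborhood of the origin, such that $\sum_{\mathbf k\in\mathbb Z^n}\chi(\mathbf u-\mathbf k)=1$ for every $\mathbf u\in\mathbb R^n$, and for a fixed $\alpha\ge0$ the absolute moment $m_\alpha(\chi):=\sup_{\mathbf u\in\mathbb R^n}\sum_{\mathbf k\in\mathbb Z^n}|\chi(\mathbf u-\mathbf k)|\,\|\mathbf u-\mathbf k\|_2^\alpha$ is finite; $m_0(\chi)=\sup_{\mathbf u}\sum_{\mathbf k}|\chi(\mathbf u-\mathbf k)|$. $L^{\overrightarrow P}(\mathbb R^n)$ is the space of measurable $f$ with $\|f\|_{\overrightarrow P}=\Big(\int_{\mathbb R}\cdots\Big(\int_{\mathbb R}\Big(\int_{\mathbb R}|f(x_1,\dots,x_n)|^{p_1}dx_1\Big)^{p_2/p_1}dx_2\Big)^{p_3/p_2}\cdots dx_n\Big)^{1/p_n}<\infty$. For a sequence $x$ on $\mathbb Z^n$, $\|x\|_{\ell^{\overrightarrow P}_w}=\Big(\frac1w\sum_{k_n}\cdots\Big(\frac1w\sum_{k_2}\Big(\frac1w\sum_{k_1}|x(k_1,\dots,k_n)|^{p_1}\Big)^{p_2/p_1}\Big)^{p_3/p_2}\cdots\Big)^{1/p_n}$. A countable set $\Gamma\subset\mathbb R^n$ is relatively separated with gap $\kappa>0$ if $1\le\inf_{\mathbf x}\sum_{\gamma\in\Gamma}\chi_{B(\gamma;\kappa/2)}(\mathbf x)$ and $\sup_{\mathbf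 x}\sum_{\gamma\in\Gamma}\chi_{B(\gamma;\kappa/2)}(\mathbf x)<\infty$, $B(\gamma;r)$ the open cube centered at $\gamma$ of side $2r$. $\Delta^{\overrightarrow P}(\mathbb R^n)$ is the set of bounded measurable $f:\mathbb R^n\to\mathbb R$ such that $\|(f(x_{\mathbf k}))_{\mathbf k\in\mathbb Z^n}\|_{\ell^{\overrightarrow P}_w}<\infty$ for every relatively separated set $(x_{\mathbf k})_{\mathbf k\in\mathbb Z^n}$. *)

(* Defs.v *)
From HB Require Import structures.
From mathcomp Require Import all_boot all_order all_algebra.
From mathcomp Require Import all_classical all_reals all_analysis.
Set Implicit Arguments. Unset Strict Implicit. Unset Printing Implicit Defensive.
Import Order.TTheory GRing.Theory Num.Theory.
Local Open Scope classical_set_scope.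
Local Open Scope ring_scope.

Section Defs.
Context {R : realType} {n : nat}.
Notation pt := ('I_n -> R).
Notation lat := {ffun 'I_n -> int}.

Definition set_coord (x : pt) (j : nat) (t : R) : pt :=
  fun i => if nat_of_ord i == j then t else x i.
Definition set_zcoord (k : lat) (j : nat) (t : int) : lat :=
  [ffun i => if nat_of_ord i == j then t else k i].

(* mixed Lebesgue norm: coordinate x_{j+1} (0-based j) integrated with exponent p j,
   innermost coordinate first *)
Definition mn_step (p : nat -> R) (j : nat) (F : pt -> \bar R) : pt -> \bar R :=
  fun x => poweR (\int[lebesgue_measure]_t poweR (F (set_coord x j t)) (p j))
                 (p j)^-1.
Fixpoint mn_iter (p : nat -> R) (m : nat) (F : pt -> \bar R) : pt -> \bar R :=
  match m with 0%N => F | m'.+1 => mn_step p m' (mn_iter p m' F) end.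
Definition mixed_norm (p : nat -> R) (f : pt -> R) : \bar R :=
  mn_iter p n (fun x => (`|f x|)%:E) (fun _ => 0).

Definition l1norm (f : pt -> R) : \bar R := mixed_norm (fun _ => 1) f.

Definition ln_step (p : nat -> R) (w : R) (j : nat) (G : lat -> \bar R) : lat -> \bar R :=
  fun k => poweR ((w^-1)%:E * esum setT (fun t : int => poweR (G (set_zcoord k j t)) (p j)))
                 (p j)^-1.
Fixpoint ln_iter (p : nat -> R) (w : R) (m : nat) (G : lat -> \bar R) : lat -> \bar R :=
  match m with 0%N => G | m'.+1 => ln_step p w m' (ln_iter p w m' G) end.
Definition lnorm (p : nat -> R) (w : R) (a : lat -> R) : \bar R :=
  ln_iter p w n (fun k => (`|a k|)%:E) [ffun=> 0].

Definition boxes : set (set pt) :=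
  [set A | exists B : 'I_n -> set R,
     (forall i, measurable (B i)) /\ A = [set x | forall i, B i (x i)]].
Definition borel_n (A : set pt) : Prop := <<s boxes >> A.
(* Lebesgue null sets / Lebesgue measurable sets of R^n (completion) *)
Definition null_n (N : set pt) : Prop := borel_n N /\ l1norm (\1_N : pt -> R) = 0%E.
Definition leb_n (A : set pt) : Prop :=
  exists B N, borel_n B /\ null_n N /\ ((A `\` B) `|` (B `\` A)) `<=` N.
Definition leb_fun (f : pt -> R) : Prop :=
  forall B : set R, measurable B -> leb_n (f @^-1` B).

(* absolutely convergent sum over Z^n (positive part minus negative part) *)
Definition zsum (a : lat -> R) : R :=
  fine (esum setT (fun k => (Num.max (a k) 0)%:E)) -
  fine (esum setT (fun k => (Num.max (- a k) 0)%:E)).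

Definition zsub (u : pt) (k : lat) : pt := fun i => u i - (k i)%:~R.
Definition euclid (v : pt) : R := Num.sqrt (\sum_i v i ^+ 2).

Definition moment0 (chi : pt -> R) : \bar R :=
  ereal_sup (range (fun u : pt => esum setT (fun k : lat => (`|chi (zsub u k)|)%:E))).
Definition moment (alpha : R) (chi : pt -> R) : \bar R :=
  ereal_sup (range (fun u : pt => esum setT (fun k : lat =>
     (`|chi (zsub u k)| * powR (euclid (zsub u k)) alpha)%:E))).

Definition is_kernel (alpha : R) (chi : pt -> R) : Prop :=
  [/\ leb_fun chi /\ (l1norm chi < +oo)%E,
      exists r M : R, 0 < r /\ forall u : pt, (forall i, `|u i| < r) -> `|chi u| <= M,
      forall u : pt, zsum (fun k => chi (zsub u k)) = 1
    & (moment alpha chi < +oo)%E].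

Definition cube (g : pt) (r : R) : set pt := [set y | forall i, `|y i - g i| < r].

Definition rel_separated (X : lat -> pt) : Prop :=
  exists kappa : R, 0 < kappa /\
    (forall x : pt, (1 <= esum setT (fun k => ((\1_(cube (X k) (kappa / 2)) x : R))%:E))%E) /\
    exists M : R, forall x : pt,
      (esum setT (fun k => ((\1_(cube (X k) (kappa / 2)) x : R))%:E) <= M%:E)%E.

Definition Delta (p : nat -> R) (w : R) (f : pt -> R) : Prop :=
  [/\ exists M : R, forall x, `|f x| <= M,
      leb_fun f
    & forall X : lat -> pt, rel_separated X -> (lnorm p w (fun k => f (X k)) < +oo)%E].

Definition kdiv (k : lat) (w : R) : pt := fun i => (k i)%:~R / w.

Definition sampling (w : R) (chi : pt -> R) (f : pt -> R) : pt -> R :=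
  fun x => zsum (fun k => f (kdiv k w) * chi (zsub (fun i => w * x i) k)).

End Defs.

(* Main.v *)
Require Import Defs.
From HB Require Import structures.
From mathcomp Require Import all_boot all_order all_algebra.
From mathcomp Require Import all_classical all_reals all_analysis.
From mathcomp Require Import measurable_realfun.
From mathcomp Require Import ring lra zify.
Import Order.TTheory GRing.Theory Num.Theory.
Import numFieldNormedType.Exports.
Set Implicit Arguments.
Unset Strict Implicit.
Unset Printing Implicit Defensive.
Local Open Scope classical_set_scope.
Local Open Scope ring_scope.

(* Integrate out one coordinate at a time.  Let g = |chi|, let g_j be the
   integral of g over its first j coordinates, A_j the iterated lattice norm of
   the samples over their first j indices, and m = m_0(chi).  With p_0 = 1,
     |S_w f|_j (x) ^ p_j <= m^(p_j - 1) * sum_k A_j(k)^(p_j) g_j(w x - k),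
   the sum running over the remaining n - j lattice indices and |S_w f|_j being
   the mixed norm over the first j variables.  The step from j to j+1 is Jensen's
   inequality with exponent p_(j+1)/p_j >= 1, followed by integration in x_(j+1)
   (substitution t = w s - k); the weights satisfy sum_k g_j(u - k) <= m because
   the integral of g_j over R is the integral over [0, 1) of its periodization.
   At j = n the sum has a single term, weighted by g_n = ||chi||_1.
   Since chi is only Lebesgue measurable, g is replaced by a Borel function equal
   to it off a Borel null set N, and the estimate is carried along the points
   where the iterated integral of the indicator of the union of the sets
   (N + k) / w vanishes. *)

(** * Sums of nonnegative extended reals over countable types *)

Section CountableSums.
Context {R : realType}.
Local Open Scope ereal_scope.

(** Enumeration by [pickle] gives a series over the naturals, with value 0 at the indices that code
    no element. Results on series of functions thereby reach sums over the lattice. *)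
Lemma esum_nneseries (T : countType) (a : T -> \bar R) :
  (forall k, 0 <= a k) ->
  \esum_(k in setT) a k = \sum_(0 <= i <oo) oapp a 0 (pickle_inv i).
Proof.
move=> a0; rewrite nneseries_esumT; last by move=> i; case: pickle_inv => /=.
have -> : (\esum_(i in [set: nat]) oapp a 0 (pickle_inv i)
    = \esum_(i in range (@pickle T)) oapp a 0 (pickle_inv i))%R.
  rewrite [RHS]esum_mkcond; apply: eq_esum => i _.
  case: ifPn => // /negP hi.
  case E : (pickle_inv i) => [x|] //=; exfalso; apply: hi; rewrite inE.
  exists x => //; have := @pickle_invK T i; by rewrite E.
rewrite esum_image; last by move=> x y _ _; exact: (pcan_inj (@pickleK_inv T)).
by apply: eq_esum => k _; rewrite pickleK_inv.
Qed.

Lemma esumZl (T : countType) (I : set T) (c : \bar R) (a : T -> \bar R) :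
  0 <= c -> (forall k, 0 <= a k) ->
  \esum_(k in I) (c * a k) = c * \esum_(k in I) a k.
Proof.
move=> c0 a0; case: c c0 => [c||//] c0.
  rewrite [LHS]esum_mkcond [in RHS]esum_mkcond !esum_nneseries; first last.
  - by move=> k; case: ifP => // _; rewrite mule_ge0.
  - by move=> k; case: ifP.
  rewrite -nneseriesZl//; last first.
    by move=> i _; case: pickle_inv => //= k; case: ifP.
  congr (limn _); apply/funext => i; apply: eq_bigr => j _.
  by case: pickle_inv => [k|] /=; [case: ifP|]; rewrite ?mule0.
(* The case [c = +oo]: both sides vanish if all terms do, and otherwise a single positive term makes
   both sides infinite. *)
have [h|] := pselect (forall k, I k -> a k = 0); last move=> /existsNP[k /not_implyP[Ik ak]].
  by rewrite !esum1 ?mule0// => k Ik; rewrite h ?mule0.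
have {}ak : 0 < a k by rewrite lt0e a0 andbT; exact/eqP.
have single (b : T -> \bar R) : (forall j, 0 <= b j) -> b k <= \esum_(j in I) b j.
  move=> b0; apply: esum_ge; exists [set k]; last by rewrite fsbig_set1.
  by split => //; move=> _ ->.
rewrite gt0_mulye; last by apply: lt_le_trans ak _; exact: single.
apply/eqP; rewrite -leye_eq; apply: le_trans (single _ _).
  by rewrite gt0_mulye.
by move=> j; rewrite mule_ge0.
Qed.

Lemma measurable_esum d (X : measurableType d) (T : countType) (I : set T)
    (f : T -> X -> \bar R) :
  (forall k x, 0 <= f k x) -> (forall k, measurable_fun [set: X] (f k)) ->
  measurable_fun [set: X] (fun x => \esum_(k in I) f k x).
Proof.
move=> f0 mf.
rewrite [X in measurable_fun _ X](_ : _ = fun x => \sum_(0 <= i <oo | i \in xpredT)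
   oapp (fun k => if k \in I then f k x else 0) 0 (pickle_inv i)).
  apply: ge0_emeasurable_sum => [i x _ _|i _].
    by case: pickle_inv => //= k; case: ifP.
  by case: pickle_inv => [k|]//=; case: (k \in I) => //; exact: measurable_cst.
apply/funext => x; rewrite esum_mkcond esum_nneseries; last first.
  by move=> k; case: ifP.
by congr (limn _); apply/funext => i; apply: eq_bigl.
Qed.

Lemma integral_esum d (X : measurableType d)
    (mu : {measure set X -> \bar R}) (D : set X) (mD : measurable D)
    (T : countType) (I : set T) (f : T -> X -> \bar R) :
  (forall k x, 0 <= f k x) -> (forall k, measurable_fun D (f k)) ->
  \int[mu]_(x in D) (\esum_(k in I) f k x)
    = \esum_(k in I) \int[mu]_(x in D) f k x.
Proof.
move=> f0 mf.
under eq_integral => x _.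
  rewrite esum_mkcond esum_nneseries//; last by move=> k; case: ifP.
  over.
rewrite integral_nneseries//; first last.
- by move=> i x _; case: pickle_inv => //= k; case: ifP.
- by move=> i; case: pickle_inv => [k|]//=; case: (k \in I) => //; exact: measurable_cst.
rewrite esum_mkcond esum_nneseries//; last first.
  by move=> k; case: ifP => // _; exact: integral_ge0.
congr (limn _); apply/funext => i; apply: eq_bigr => j _.
case: pickle_inv => [k|] /=; last exact: integral0.
by case: (k \in I) => //; rewrite integral0.
Qed.

End CountableSums.

(** * Comparing integrals without measurability of the smaller function *)

Section LowerIntegral.
Context d (X : measurableType d) {R : realType}
  (mu : {measure set X -> \bar R}).
Local Open Scope ereal_scope.

(* The integral of a nonnegative function is a supremum over simple minorants,
   so comparing it with the integral of a larger one needs no measurability. *)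
Lemma ge0_le_lower_integral (f g : X -> \bar R) :
  (forall x, 0 <= f x) -> (forall x, f x <= g x) ->
  \int[mu]_x f x <= \int[mu]_x g x.
Proof.
move=> f0 fg; rewrite !ge0_integralTE//; last first.
  by move=> x; exact: le_trans (f0 x) (fg x).
apply: le_ereal_sup => _ [h /= hf <-]; exists h => //= x.
exact: le_trans (hf x) (fg x).
Qed.

(** The exceptional set is where [h] is nonzero. Adding [+oo * h] to [g] yields a majorant of [f]
    everywhere, at no cost in the integral. Measurability is asked of [g] and [h] only, because [f]
    will be built from the sampled series, which is merely Lebesgue measurable. *)
Lemma ae_le_lower_integral (f g h : X -> \bar R) :
  (forall x, 0 <= f x) -> (forall x, 0 <= g x) -> (forall x, 0 <= h x) ->
  measurable_fun [set: X] g -> measurable_fun setT h ->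
  \int[mu]_x h x = 0 -> (forall x, h x = 0 -> f x <= g x) ->
  \int[mu]_x f x <= \int[mu]_x g x.
Proof.
move=> f0 g0 h0 mg mh ih fg.
have mhy : measurable_fun [set: X] (fun x => +oo * h x).
  by apply: emeasurable_funM => //; exact: measurable_cst.
apply: (@le_trans _ _ (\int[mu]_x (g x + +oo * h x))).
  apply: ge0_le_lower_integral => // x.
  have [/fg|hx] := eqVneq (h x) 0.
    by move=> /le_trans; apply; rewrite leeDl// mule_ge0.
  rewrite gt0_mulye ?lt0e ?hx//= addey ?leey//.
  by rewrite -ltNye (lt_le_trans _ (g0 x)).
rewrite ge0_integralD//; last by move=> x _; rewrite mule_ge0.
by rewrite ge0_integralZl// ih mule0 adde0.
Qed.

End LowerIntegral.

(** * Affine substitution and periodization on the line *)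

Section AffineSubstitution.
Context {R : realType}.
Local Open Scope ereal_scope.

Lemma measurable_affine (w c : R) :
  measurable_fun [set: R] (fun s : R => (w * s - c)%R).
Proof.
apply: measurable_funB; last exact: measurable_cst.
by apply: measurable_funM => //; exact: measurable_cst.
Qed.

(** Lebesgue measure equals [w] times its pushforward under s -> w s - c: the two agree on the
    intervals ]a, b], and uniqueness of Lebesgue measure does the rest. *)
Lemma ge0_integral_affine (w c : R) (h : R -> \bar R) : (0 < w)%R ->
  (forall t, 0 <= h t) -> measurable_fun [set: R] h ->
  \int[lebesgue_measure]_s h (w * s - c)%R
    = (w^-1)%:E * \int[lebesgue_measure]_t h t.
Proof.
move=> w0 h0 mh; pose phi (s : measurableTypeR R) : measurableTypeR R := (w * s - c)%R.
have mphi : measurable_fun setT phi by exact: measurable_affine.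
pose push : measure (measurableTypeR R) R := pushforward (@lebesgue_measure R) phi.
pose push_phi := push mphi.
pose wnn : {nonneg R} := NngNum (ltW w0).
have eqm (A : set (measurableTypeR R)) : measurable A ->
    lebesgue_measure A = mscale wnn push_phi A.
  apply: lebesgue_measure_unique => _ [[a b] _ <-] /=.
  rewrite /mscale/= /pushforward.
  have -> : phi @^-1` `]a, b] = `](((a + c) / w)%R), (((b + c) / w)%R)]%classic.
    apply/seteqP; split => s /=; rewrite !in_itv /= /phi.
      by rewrite ltr_pdivrMr// ler_pdivlMr// ltrBrDr lerBlDr mulrC.
    by rewrite ltr_pdivrMr// ler_pdivlMr// ltrBrDr lerBlDr mulrC.
  rewrite !lebesgue_measure_itv/= !lte_fin ltr_pM2r ?invr_gt0// ltrD2r.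
  case: ifPn => _; last by rewrite mule0.
  rewrite -!EFinB -EFinM; congr EFin.
  by rewrite -mulrBl mulrCA divff ?gt_eqF// mulr1; ring.
rewrite [in RHS](eq_measure_integral (mscale wnn push_phi)); last first.
  by move=> A mA _; exact: eqm.
rewrite ge0_integral_mscale//= ge0_integral_pushforward//.
by rewrite preimage_setT muleA -EFinM mulVf ?gt_eqF// mul1e.
Qed.

(** The integer translates of the indicator [u] of [0, 1[ sum to 1. Insert this sum, exchange it
    with the integral, and translate the m-th term by m. *)
Lemma integral_periodization (h : R -> \bar R) :
  (forall t, 0 <= h t) -> measurable_fun [set: R] h ->
  \int[lebesgue_measure]_t h t
    = \int[lebesgue_measure]_(t in `[0%R, 1%R[)
        (\esum_(m in [set: int]) h (t - m%:~R)%R).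
Proof.
move=> h0 mh.
pose u (t : R) : \bar R := (\1_`[0%R, 1%R[%classic t)%:E.
have u0 t : 0 <= u t by rewrite lee_fin.
have mu : measurable_fun [set: R] u.
  by apply: measurableT_comp => //; exact: measurable_indic.
have hshift (m : int) : measurable_fun [set: R] (fun t : R => h (t - m%:~R)%R).
  by apply: measurableT_comp => //; apply: measurable_funB => //; exact: measurable_cst.
have usum (t : R) : \esum_(m in [set: int]) u (t + m%:~R)%R = 1.
  (* The only integer that brings t into [0, 1[. *)
  pose k := (- Num.floor t)%R.
  have uk m : u (t + m%:~R)%R = if m \in [set k] then 1 else 0.
    rewrite /u indicE; case: ifPn => [|mk]; first (rewrite inE => /= ->).
      rewrite mem_set//= in_itv/= /k rmorphN/= subr_ge0 ltrBlDr addrC.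
      by have := floor_itv t; rewrite rmorphD.
    rewrite memNset//= in_itv/= => /andP[t0 t1]; apply: (negP mk); rewrite inE /=.
    suff : Num.floor t = (- m)%R by rewrite /k => ->; rewrite opprK.
    by apply: floor_def; rewrite rmorphD rmorphN/=; apply/andP; split; lra.
  under eq_esum do rewrite uk.
  by rewrite -esum_mkcond esum_set1.
transitivity (\int[lebesgue_measure]_t (\esum_(m in [set: int]) (h t * u (t + m%:~R)%R))).
  apply: eq_integral => t _; rewrite esumZl// usum mule1//.
have mushift (m : int) : measurable_fun [set: R] (fun t : R => u (t + m%:~R)%R).
  by apply: measurableT_comp => //; apply: measurable_funD => //; exact: measurable_cst.
rewrite (integral_esum _ measurableT); first last.
- by move=> m; exact: (emeasurable_funM mh (mushift m)).
- by move=> m t; rewrite mule_ge0.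
transitivity (\esum_(m in [set: int]) \int[lebesgue_measure]_t (h (t - m%:~R)%R * u t)).
  apply: eq_esum => m _.
  have := @ge0_integral_affine 1 m%:~R (fun t => h t * u (t + m%:~R)%R) ltr01.
  rewrite invr1 mul1e => <-.
  - by apply: eq_integral => t _; rewrite mul1r subrK.
  - by move=> t; rewrite mule_ge0.
  - exact: emeasurable_funM mh (mushift m).
rewrite -(integral_esum _ measurableT); first last.
- by move=> m; exact: (emeasurable_funM (hshift m) mu).
- by move=> m t; rewrite mule_ge0.
rewrite [RHS]integral_mkcond; apply: eq_integral => t _.
rewrite patchE; under eq_esum do rewrite muleC.
rewrite esumZl// /u indicE; case: (t \in _); by rewrite ?mul1e ?mul0e.
Qed.

End AffineSubstitution.

(** * Jensen's inequality for weights of total mass at most m *)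

Section Jensen.
Context {R : realType}.
Local Open Scope ereal_scope.

(** By convexity the graph of b^q lies above its tangent at c. The constant term is moved to the
    right, so that no subtraction of extended reals occurs. *)
Lemma young_tangent (q c : R) (b : \bar R) : (1 <= q)%R -> (0 < c)%R -> 0 <= b ->
  (q * c `^ (q - 1))%:E * b <= b `^ q + ((q - 1) * c `^ q)%:E.
Proof.
move=> q1 c0; have q0 : (0 < q)%R by exact: lt_le_trans q1.
case: b => [b| |//] b0; last first.
  rewrite poweRyr ?gt_eqF// addye// leey//.
rewrite poweR_EFin -EFinM -EFinD lee_fin; rewrite lee_fin in b0.
have := q1; rewrite le_eqVlt => /predU1P[<-|q1'].
  by rewrite subrr powRr0 mul0r addr0 !mul1r powRr1.
(* Young's inequality for b * c^(q-1), with conjugate exponent q/(q-1). *)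
have q10 : (0 < q - 1)%R by rewrite subr_gt0.
have := @conjugate_powR _ b (c `^ (q - 1))%R q (q / (q - 1))%R b0 (powR_ge0 _ _) q0.
rewrite divr_gt0// => /(_ isT).
have -> : (q^-1 + (q / (q - 1))^-1 = 1)%R.
  by field; rewrite !gt_eqF.
move=> /(_ erefl); rewrite -powRrM.
have -> : ((q - 1) * (q / (q - 1)) = q)%R by field; rewrite gt_eqF.
have -> : (c `^ q / (q / (q - 1)) = (q - 1) * c `^ q / q)%R by field; rewrite !gt_eqF.
rewrite -mulrDl ler_pdivlMr//.
by rewrite mulrC mulrA [X in (X * _ <= _)%R]mulrC -mulrA [(_ * b)%R]mulrC mulrA.
Qed.

(** The tangent inequality at c, summed against the weights [g], gives one linear bound on S for
    each c > 0 ([main]). The optimal choice is c = S / m. *)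
Lemma jensen_esum (T : countType) (I : set T) (b g : T -> \bar R) (m q : R) :
  (1 <= q)%R -> (0 < m)%R -> (forall k, 0 <= b k) -> (forall k, 0 <= g k) ->
  \esum_(k in I) g k <= m%:E ->
  (\esum_(k in I) (b k * g k)) `^ q
    <= (m `^ (q - 1))%:E * \esum_(k in I) (b k `^ q * g k).
Proof.
move=> q1 m0 b0 g0 gm; set S := esum I _; set T' := esum I _.
have q0 : (0 < q)%R by exact: lt_le_trans q1.
have S0 : 0 <= S by apply: esum_ge0 => k _; rewrite mule_ge0.
have T0 : 0 <= T' by apply: esum_ge0 => k _; rewrite mule_ge0// poweR_ge0.
have main c : (0 < c)%R -> (q * c `^ (q - 1))%:E * S <= T' + ((q - 1) * c `^ q * m)%:E.
  move=> c0.
  have cq : (0 <= (q - 1) * c `^ q)%R by rewrite mulr_ge0 ?subr_ge0// powR_ge0.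
  have cq' : (0 <= q * c `^ (q - 1))%R by rewrite mulr_ge0 ?powR_ge0// ltW.
  rewrite -esumZl//; last by move=> k; rewrite mule_ge0.
  apply: (@le_trans _ _ (\esum_(k in I) (b k `^ q * g k + ((q - 1) * c `^ q)%:E * g k))).
    apply: le_esum => k _; rewrite muleA -ge0_muleDl// ?poweR_ge0//.
    by apply: lee_wpmul2r => //; exact: young_tangent.
  rewrite esumD; last 2 first.
  - by move=> k _; rewrite mule_ge0// poweR_ge0.
  - by move=> k _; rewrite mule_ge0.
  by rewrite leeD2l// esumZl// [in leRHS]EFinM; apply: lee_wpmul2l.
have [->|Ty] := eqVneq T' +oo.
  by rewrite gt0_muley ?leey// lte_fin powR_gt0.
have Tfin : T' \is a fin_num by rewrite ge0_fin_numE// ltey.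
(* Finiteness of S comes from the bound at c = 1. *)
have Sfin : S \is a fin_num.
  rewrite ge0_fin_numE//; have := main 1%R ltr01.
  rewrite -(fineK Tfin) -EFinD !powR1 mulr1; case: (S) S0 => [s| |]//= _; first by rewrite ltry.
  by rewrite gt0_muley ?lte_fin.
have [->|Sn0] := eqVneq S 0.
  by rewrite poweR0r ?gt_eqF// mule_ge0// lee_fin powR_ge0.
have s0 : (0 < fine S)%R by rewrite fine_gt0// lt0e Sn0 S0 -ge0_fin_numE.
(* Here c^(q-1) S = c^q m, so the bound reduces to c^q m <= T', and S^q = m^(q-1) c^q m. *)
have := main (fine S / m)%R (divr_gt0 s0 m0).
rewrite -(fineK Tfin) -(fineK Sfin) poweR_EFin -EFinD -!EFinM !lee_fin.
set s := fine S in s0 *; set t := fine T'; set c := (s / m)%R.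
have c0 : (0 < c)%R by exact: divr_gt0.
have cq : (c `^ (q - 1) * s = c `^ q * m)%R.
  have -> : s = (c * m)%R by rewrite /c divfK ?gt_eqF.
  rewrite mulrA -[X in (_ * X * _)%R]powRr1 ?ltW// -powRD ?subrK//.
  by rewrite gt_eqF ?implybT.
rewrite -(mulrA q) cq => H.
have {}H : (c `^ q * m <= t)%R by lra.
have -> : (s `^ q = m `^ (q - 1) * (c `^ q * m))%R.
  rewrite mulrCA -[X in (_ * (_ * X))%R]powRr1 ?ltW// -powRD; last first.
    by rewrite (gt_eqF m0) implybT.
  by rewrite subrK -powRM ?ltW// /c divfK ?gt_eqF.
by rewrite ler_wpM2l// powR_ge0.
Qed.

End Jensen.

(** * Borel measurability on R^n and iterated integrals (all exponents 1) *)

Section BorelPoints.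
Context {R : realType} {n : nat}.
Notation pt := ('I_n -> R).
Notation lat := {ffun 'I_n -> int}.
Notation bpt := (g_sigma_algebraType (@boxes R n)).
Local Open Scope ereal_scope.

Lemma measurable_pt d (Y : measurableType d) (phi : Y -> bpt) :
  (forall i, measurable_fun [set: Y] (fun y => phi y i)) ->
  measurable_fun [set: Y] phi.
Proof.
move=> mphi; apply: (@measurability _ _ Y bpt _ _ (@boxes R n : set (set bpt))) => //.
move=> _ [_ [B [mB ->]] <-]; rewrite setTI.
rewrite (_ : _ @^-1` _ = \bigcap_(i in [set: 'I_n]) ((fun y => phi y i) @^-1` B i)).
  apply: fin_bigcap_measurable => // i _.
  by rewrite -[X in measurable X]setTI; exact: mphi.
by apply/seteqP; split => y /=; [move=> h i _; exact: h|move=> h i; exact: h].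
Qed.

Lemma measurable_coord (i : 'I_n) : measurable_fun [set: bpt] (fun x : bpt => x i).
Proof.
move=> _ B mB; rewrite setTI; apply: sub_sigma_algebra.
exists (fun j => if j == i then B else setT); split => [j|].
  by case: ifP.
apply/seteqP; split => x /=; first by move=> Bx j; case: eqP => // ->.
by move=> /(_ i); rewrite eqxx.
Qed.

Lemma measurable_set_coord (j : nat) :
  measurable_fun [set: bpt * R] (fun z : bpt * R => set_coord z.1 j z.2 : bpt).
Proof.
apply: measurable_pt => i; rewrite /set_coord; case: (nat_of_ord i == j).
  exact: measurable_snd.
exact: (measurableT_comp (measurable_coord i) measurable_fst).
Qed.

Lemma measurable_set_coord2 (x : bpt) (j : nat) :
  measurable_fun [set: R] (fun t : R => set_coord x j t : bpt).
Proof.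
apply: measurable_pt => i; rewrite /set_coord.
by case: (nat_of_ord i == j) => //; exact: measurable_cst.
Qed.

Lemma measurable_zsub (w : R) (k : lat) :
  measurable_fun [set: bpt] (fun x : bpt => zsub (fun i => w * x i)%R k : bpt).
Proof.
apply: measurable_pt => i; rewrite /zsub; apply: measurable_funB => //.
apply: measurable_funM => //; exact: measurable_coord.
Qed.

Local Notation J := (mn_iter (fun=> 1%R)).

Lemma mn_iter_ge0 p j (F : pt -> \bar R) x :
  (forall x, 0 <= F x) -> 0 <= mn_iter p j F x.
Proof. by move=> F0; case: j => //= j; exact: poweR_ge0. Qed.

Lemma mn_iter1S j (F : pt -> \bar R) x : (forall x, 0 <= F x) ->
  J j.+1 F x = \int[lebesgue_measure]_t J j F (set_coord x j t).
Proof.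
move=> F0; rewrite /= /mn_step invr1.
under eq_integral do rewrite poweRe1 ?mn_iter_ge0//.
by rewrite poweRe1// integral_ge0// => t _; exact: mn_iter_ge0.
Qed.

(** Each integration is a Tonelli section integral of a function jointly measurable in the point and
    the new coordinate. *)
Lemma measurable_mn_iter1 j (F : bpt -> \bar R) : (forall x, 0 <= F x) ->
  measurable_fun [set: bpt] F -> measurable_fun [set: bpt] (J j F : bpt -> \bar R).
Proof.
move=> F0 mF; elim: j => // j IH.
rewrite (_ : J j.+1 F = fubini_F (@lebesgue_measure R)
    (fun z : bpt * _ => J j F (set_coord z.1 j z.2))); last first.
  by apply/funext => x; rewrite mn_iter1S.
apply: measurable_fun_fubini_tonelli_F; last by move=> z; exact: mn_iter_ge0.
by apply: (measurableT_comp IH); exact: measurable_set_coord.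
Qed.

Lemma measurable_mn_iter1_coord j (F : bpt -> \bar R) x : (forall x, 0 <= F x) ->
  measurable_fun [set: bpt] F ->
  measurable_fun [set: R] (fun t => J j F (set_coord x j t)).
Proof.
move=> F0 mF; apply: (measurableT_comp (measurable_mn_iter1 j F0 mF)).
exact: measurable_set_coord2.
Qed.

Lemma le_mn_iter1 j (F G : pt -> \bar R) x : (forall x, 0 <= F x) ->
  (forall x, F x <= G x) -> J j F x <= J j G x.
Proof.
move=> F0 FG; have G0 y : 0 <= G y by exact: le_trans (FG y).
elim: j x => // j IH x; rewrite !mn_iter1S//.
by apply: ge0_le_lower_integral => // t; exact: mn_iter_ge0.
Qed.

(** The coordinates below j have been overwritten by integration variables. For j = n the value is a
    constant. *)
Lemma mn_iter_indep p j (F : pt -> \bar R) x y :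
  (forall i : 'I_n, (j <= i)%N -> x i = y i) -> mn_iter p j F x = mn_iter p j F y.
Proof.
elim: j x y => [|j IH] x y xy.
  by congr F; apply/funext => i; exact: xy.
rewrite /= /mn_step; congr poweR; apply: eq_integral => t _; congr poweR.
apply: IH => i ji; rewrite /set_coord; case: eqP => // /eqP ij.
by apply: xy; rewrite ltn_neqAle eq_sym ij.
Qed.

Lemma zsub_set_coord (w : R) (x : pt) (k : lat) (j : 'I_n) (s : R) :
  zsub (fun i => w * set_coord x j s i)%R k
  = set_coord (zsub (fun i => w * x i)%R k) j (w * s - (k j)%:~R)%R.
Proof.
apply/funext => i; rewrite /zsub /set_coord; case: eqP => // ij.
by rewrite (_ : i = j) //; exact: val_inj.
Qed.

(** Substitution t = w s - k_j. The factor 1/w it produces is the one in the definition of the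
    lattice norm. *)
Lemma integral_mn_iter1_zsub (w : R) (k : lat) (j : 'I_n) (F : bpt -> \bar R) x :
  (0 < w)%R -> (forall x, 0 <= F x) -> measurable_fun [set: bpt] F ->
  \int[lebesgue_measure]_s J j F (zsub (fun i => w * set_coord x j s i)%R k)
  = (w^-1)%:E * J j.+1 F (zsub (fun i => w * x i)%R k).
Proof.
move=> w0 F0 mF; under eq_integral do rewrite zsub_set_coord.
rewrite (ge0_integral_affine _ (h := fun s => J j F
  (set_coord (zsub (fun i => w * x i)%R k) j s)))// ?mn_iter1S//.
- by move=> t; exact: mn_iter_ge0.
- exact: measurable_mn_iter1_coord.
Qed.

Lemma mn_iter1_zsub (w : R) (k : lat) j (F : bpt -> \bar R) x : (j <= n)%N ->
  (0 < w)%R -> (forall x, 0 <= F x) -> measurable_fun [set: bpt] F ->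
  J j (fun x => F (zsub (fun i => w * x i)%R k)) x
  = (w^-1 ^+ j)%:E * J j F (zsub (fun i => w * x i)%R k).
Proof.
move=> jn w0 F0 mF; elim: j jn x => [|j IH] jn x; first by rewrite mul1e.
rewrite mn_iter1S//.
under eq_integral do rewrite IH ?(ltnW jn)//.
have mJ : measurable_fun [set: bpt] (fun y : bpt => J j F (zsub (fun i => w * y i)%R k)).
  by apply: (measurableT_comp (measurable_mn_iter1 j F0 mF)); exact: measurable_zsub.
rewrite ge0_integralZl//; first last.
- by rewrite lee_fin exprn_ge0// invr_ge0 ltW.
- by move=> t _; exact: mn_iter_ge0.
- by apply: (measurableT_comp mJ); exact: measurable_set_coord2.
rewrite (integral_mn_iter1_zsub k (Ordinal jn))//.
by rewrite muleA -EFinM -exprSr.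
Qed.

Lemma mn_iter1_esum (T : countType) (I : set T) j (f : T -> bpt -> \bar R) x :
  (forall k x, 0 <= f k x) -> (forall k, measurable_fun [set: bpt] (f k)) ->
  J j (fun x => \esum_(k in I) f k x) x = \esum_(k in I) J j (f k) x.
Proof.
move=> f0 mf; have s0 y : 0 <= \esum_(k in I) f k y by exact: esum_ge0.
elim: j x => // j IH x; rewrite mn_iter1S//.
under eq_integral do rewrite IH.
rewrite (integral_esum _ measurableT); first last.
- by move=> k; exact: measurable_mn_iter1_coord.
- by move=> k t; exact: mn_iter_ge0.
by apply: eq_esum => k _; rewrite mn_iter1S.
Qed.

End BorelPoints.

(** * Null sets and Borel representatives *)

Section NullSets.
Context {R : realType} {n : nat}.
Notation pt := ('I_n -> R).
Notation lat := {ffun 'I_n -> int}.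
Notation bpt := (g_sigma_algebraType (@boxes R n)).
Local Open Scope ereal_scope.
Local Notation J := (mn_iter (fun=> 1%R)).

Lemma measurable_indicE (N : set bpt) : measurable N ->
  measurable_fun [set: bpt] (fun x : bpt => (\1_N x : R)%:E).
Proof. by move=> mN; apply: measurableT_comp => //; exact: measurable_indic. Qed.

Lemma null_nP (N : set pt) : borel_n N ->
  null_n N <-> J n (fun x => (\1_N x : R)%:E) (fun=> 0%R) = 0.
Proof.
move=> bN; rewrite /null_n /l1norm /mixed_norm.
under [X in mn_iter _ _ X]eq_fun do rewrite ger0_norm//.
by split => [[]|].
Qed.

(** The indicator of the union is at most the sum of the indicators, and iterated integrals commute
    with countable sums. *)
Lemma null_n_bigcup (T : countType) (N : T -> set pt) :
  (forall k, null_n (N k)) -> null_n (\bigcup_k N k).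
Proof.
move=> nN; have mN k : measurable (N k : set bpt) by exact: (nN k).1.
have mU : measurable (\bigcup_k (N k : set bpt)) by apply: countable_bigcupT_measurable.
apply/null_nP => //; apply/eqP; rewrite eq_le mn_iter_ge0 ?andbT; last first.
  by move=> x; rewrite lee_fin.
pose s (x : pt) := \esum_(k in [set: T]) (\1_(N k) x : R)%:E.
apply: (@le_trans _ _ (J n s (fun=> 0%R))).
  apply: le_mn_iter1 => x; first by rewrite lee_fin.
  rewrite indicE; case: (boolP (x \in _)) => [|_]; last first.
    by apply: esum_ge0 => k _; rewrite lee_fin.
  rewrite inE => -[k _ Nk]; apply: esum_ge; exists [set k].
    by split => //.
  by rewrite fsbig_set1 indicE mem_set.
rewrite /s mn_iter1_esum; first last.
- by move=> k; exact: measurable_indicE.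
- by move=> k x; rewrite lee_fin.
by rewrite esum1// => k _; apply/null_nP; [exact: mN|].
Qed.

Lemma null_n_zsub (w : R) (k : lat) (N : set pt) : (0 < w)%R -> null_n N ->
  null_n [set x : pt | N (zsub (fun i => w * x i)%R k)].
Proof.
move=> w0 nN; have mN : measurable (N : set bpt) by exact: nN.1.
have mN' : measurable ([set x : pt | N (zsub (fun i => w * x i)%R k)] : set bpt).
  by rewrite -[X in measurable X]setTI; exact: measurable_zsub.
apply/null_nP => //.
rewrite (@mn_iter1_zsub _ _ w k n (fun x => (\1_N x : R)%:E))//; first last.
- exact: measurable_indicE.
rewrite (@mn_iter_indep _ _ _ n _ _ (fun=> 0%R)); last first.
  by move=> i; rewrite leqNgt ltn_ord.
by rewrite (null_nP _).1// mule0.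
Qed.

(** For each rational q the set {f < q} agrees with a Borel set off a null set. [N] collects these
    countably many null sets, and [f] is reset to 0 on it. *)
Lemma leb_funE (f : pt -> R) : leb_fun f ->
  exists2 N : set pt, null_n N &
    measurable_fun [set: bpt] (fun x : bpt => if x \in N then 0%R else f x).
Proof.
move=> lf.
have /choice[B hB] : forall q : rat, exists BN : set pt * set pt,
    [/\ borel_n BN.1, null_n BN.2 & forall x, ~ BN.2 x ->
      ((f x < ratr q)%R <-> BN.1 x)].
  move=> q; have [|B [N [bB [nN h]]]] := lf `]-oo, ratr q[%classic.
    exact: measurable_itv.
  exists (B, N); split => // x /= Nx; split => [fq|Bx].
    apply: contrapT => Bx; apply: Nx; apply: h; left; split => //=.
  apply: contrapT => fq; apply: Nx; apply: h; right; split => //=.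
exists (\bigcup_q (B q).2).
  by apply: null_n_bigcup => q; case: (hB q).
set N := \bigcup_q _.
have mN : measurable (N : set bpt).
  by apply: bigcupT_measurable_rat => q; case: (hB q) => _ [].
apply: (measurability _ (RGenInftyO.measurableE R)) => //.
move=> _ [_ [x ->] <-]; rewrite setTI.
(* A value lies below x iff it lies below some rational q < x. On [N] the value is 0, so [N] enters
   exactly for q > 0. *)
rewrite (_ : _ @^-1` _ = \bigcup_(q : rat) (if (ratr q < x)%R then
    ((B q).1 `\` N) `|` (if (0 < q)%R then N else set0) else set0)).
  apply: bigcupT_measurable_rat => q; case: ifP => // _.
  apply: measurableU; last by case: ifP.
  by apply: measurableD => //; case: (hB q).
apply/seteqP; split => y /=; rewrite in_itv/=; last first.
  move=> [q _]; case: ifP => // qx [[By Ny]|].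
    rewrite memNset//; apply: lt_trans qx.
    by case: (hB q) => _ _ /(_ y) [] => [Bq|_ /(_ By)//]; apply: Ny; exists q.
  by case: ifP => // q0 Ny; rewrite mem_set//; apply: lt_trans qx; rewrite ltr0q.
move=> hx; have [q] := rat_in_itvoo hx; rewrite in_itv/= => /andP[yq qx].
exists q => //; rewrite qx; case: ifPn yq; rewrite (inE, notin_setE) => Ny yq.
  by right; rewrite ltr0q in yq; rewrite yq.
left; split => //; case: (hB q) => _ _ /(_ y) [] => [Bq|/(_ yq)//].
by apply: Ny; exists q.
Qed.

Lemma leb_fun_ae_eq (f g : pt -> R) (N : set pt) : null_n N ->
  measurable_fun [set: bpt] (g : bpt -> R) -> (forall x, ~ N x -> f x = g x) ->
  leb_fun f.
Proof.
move=> nN mg fg B mB; exists (g @^-1` B), N; split.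
  by have := mg measurableT _ mB; rewrite setTI.
split => // x h; apply: contrapT => Nx; move: h.
by rewrite /setD /= fg//; tauto.
Qed.

End NullSets.

(** * Lattice sums of the partially integrated kernel *)

Section LatticeSums.
Context {R : realType} {n : nat}.
Notation pt := ('I_n -> R).
Notation lat := {ffun 'I_n -> int}.
Notation bpt := (g_sigma_algebraType (@boxes R n)).
Local Open Scope ereal_scope.
Local Notation J := (mn_iter (fun=> 1%R)).

(* A copy of Z^(n-j) inside Z^n: it indexes the sums left after the first j
   coordinates have been integrated out. *)
Definition lowzero (j : nat) : set lat :=
  [set k | forall i : 'I_n, (i < j)%N -> k i = 0%R].

Lemma lowzero0 : lowzero 0 = setT.
Proof. by apply/seteqP; split. Qed.

Lemma lowzeron : lowzero n = [set [ffun=> 0%R]].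
Proof.
apply/seteqP; split => k /=; last by move=> -> i _; rewrite ffunE.
by move=> k0; apply/ffunP => i; rewrite ffunE k0.
Qed.

(** An index whose first j entries vanish is a pair: its j-th entry, and the same index with that
    entry set to 0. *)
Lemma esum_lowzeroS (j : 'I_n) (a : lat -> \bar R) : (forall k, 0 <= a k) ->
  \esum_(k in lowzero j) a k
  = \esum_(k in lowzero j.+1) \esum_(t in [set: int]) a (set_zcoord k j t).
Proof.
move=> a0; rewrite esum_esum//.
apply: (@reindex_esum _ _ _ _ _ (fun z : lat * int => set_zcoord z.1 j z.2)).
split.
- move=> [k t] [/= kl _] i ij; rewrite ffunE ltn_eqF//.
  by apply: kl; exact: ltnW.
- move=> [k t] [k' t'] /=; rewrite !inE => -[/= kl _] [/= kl' _] /ffunP E.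
  have := E j; rewrite !ffunE eqxx => ->; congr pair; apply/ffunP => i.
  have [ij|ij] := eqVneq (nat_of_ord i) j.
    by rewrite kl ?kl'// ij.
  by have := E i; rewrite !ffunE (negbTE ij).
- move=> k kl; exists (set_zcoord k j 0%R, k j).
    split => //= i; rewrite ltnS leq_eqVlt ffunE => /predU1P[->|ij].
      by rewrite eqxx.
    by rewrite ltn_eqF//; exact: kl.
  apply/ffunP => i; rewrite !ffunE; case: eqP => // ij; congr (k _).
  exact/esym/val_inj.
Qed.

Lemma zsub_set_zcoord (u : pt) (k : lat) (j : nat) (t : R) (m : int) :
  zsub (set_coord u j t) (set_zcoord k j m) = set_coord (zsub u k) j (t - m%:~R)%R.
Proof.
by apply/funext => i; rewrite /zsub /set_coord ffunE; case: eqP.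
Qed.

(** Periodizing in coordinate j replaces the integral over R by one over [0, 1[ of a sum over k_j.
    With the outer sum this forms the sum over [lowzero j], at most m by induction, and [0, 1[ has
    length 1. *)
Lemma esum_mn_iter1_le (g : bpt -> \bar R) (m : R) (j : nat) (u : pt) : (j <= n)%N ->
  (forall x, 0 <= g x) -> measurable_fun [set: bpt] g ->
  (forall v : pt, \esum_(k in [set: lat]) g (zsub v k) <= m%:E) ->
  \esum_(k in lowzero j) J j g (zsub u k) <= m%:E.
Proof.
move=> jn g0 mg gm; elim: j jn u => [|j IH] jn u; first by rewrite lowzero0.
have Jg0 y : 0 <= J j g y by exact: mn_iter_ge0.
have mJg y : measurable_fun [set: R] (fun t => J j g (set_coord y j t)).
  exact: measurable_mn_iter1_coord.
pose G (k : lat) (t : R) := \esum_(l in [set: int]) J j g (set_coord (zsub u k) j (t - l%:~R)%R).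
have mG k : measurable_fun [set: R] (G k).
  apply: measurable_esum => // l; apply: (measurableT_comp (mJg _)).
  by apply: measurable_funB => //; exact: measurable_cst.
have -> : \esum_(k in lowzero j.+1) J j.+1 g (zsub u k)
    = \esum_(k in lowzero j.+1) \int[lebesgue_measure]_(t in `[0%R, 1%R[) G k t.
  by apply: eq_esum => k _; rewrite mn_iter1S// integral_periodization.
rewrite -integral_esum//; last first.
- by move=> k; exact: (measurable_funTS (mG k)).
- by move=> k t; exact: esum_ge0.
apply: (@le_trans _ _ (\int[lebesgue_measure]_(t in `[0%R, 1%R[) (cst m%:E t))).
  rewrite [leLHS]integral_mkcond [leRHS]integral_mkcond.
  apply: ge0_le_lower_integral => t; rewrite !patchE; case: ifP => // _.
    by apply: esum_ge0 => k _; exact: esum_ge0.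
  apply: le_trans (IH (ltnW jn) (set_coord u j t)).
  rewrite (esum_lowzeroS (Ordinal jn))//; apply: le_esum => k _.
  by apply: le_esum => l _; rewrite zsub_set_zcoord.
rewrite integral_cst//= lebesgue_measure_itv/= lte_fin ltr01 -EFinB subr0.
by rewrite mule1.
Qed.

End LatticeSums.

(** * The induction over the coordinates *)

Section MainEstimate.
Context {R : realType} {n : nat}.
Notation pt := ('I_n -> R).
Notation lat := {ffun 'I_n -> int}.
Notation bpt := (g_sigma_algebraType (@boxes R n)).
Local Open Scope ereal_scope.
Local Notation J := (mn_iter (fun=> 1%R)).

Lemma ln_iter_ge0 p (w : R) j (A : lat -> \bar R) k :
  (forall k, 0 <= A k) -> 0 <= ln_iter p w j A k.
Proof. by move=> A0; case: j => //= j; exact: poweR_ge0. Qed.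

Lemma poweRVK (x : \bar R) (r : R) : (0 < r)%R -> 0 <= x -> (x `^ r^-1) `^ r = x.
Proof. by move=> r0 x0; rewrite -poweRrM mulVf ?gt_eqF// poweRe1. Qed.

Lemma le_poweR (x y : \bar R) (r : R) : (0 <= r)%R -> 0 <= x -> x <= y ->
  x `^ r <= y `^ r.
Proof.
move=> r0 x0 xy; apply: gt0_ler_poweR => //; rewrite in_itv/= leey andbT//.
exact: le_trans xy.
Qed.

(** The exponent of the last coordinate integrated. The value 1 at j = 0 makes the base case the
    pointwise bound [FA]. *)
Definition prev_exponent (p : nat -> R) (j : nat) : R :=
  if j is j'.+1 then p j' else 1%R.

(** To be read as follows: [g] is the Borel version of |chi|, [m] is m_0(chi), [A] the moduli of the
    samples, [F] the modulus of S_w f, and [N] the null set off which the series bound holds. *)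
Variables (w : R) (p : nat -> R) (g : bpt -> \bar R) (m : R) (N : set pt)
  (A : lat -> \bar R) (F : pt -> \bar R).
Hypotheses (w0 : (0 < w)%R) (p1 : (1 <= p 0)%R)
  (pmono : forall i j : nat, (i <= j < n)%N -> (p i <= p j)%R)
  (g0 : forall x, 0 <= g x) (mg : measurable_fun [set: bpt] g) (m0 : (0 < m)%R)
  (gm : forall v : pt, \esum_(k in [set: lat]) g (zsub v k) <= m%:E)
  (nN : null_n N) (A0 : forall k, 0 <= A k) (F0 : forall x, 0 <= F x)
  (FA : forall x, ~ N x ->
    F x <= \esum_(k in [set: lat]) (A k * g (zsub (fun i => w * x i)%R k))).

Let indN (x : pt) := (\1_N x : R)%:E.

Let indN0 x : 0 <= indN x. Proof. by rewrite lee_fin. Qed.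

Let mindN : measurable_fun [set: bpt] (indN : bpt -> \bar R).
Proof. by apply: measurable_indicE; exact: nN.1. Qed.

Lemma p_ge1 j : (j < n)%N -> (1 <= p j)%R.
Proof. by move=> jn; apply: le_trans p1 _; apply: pmono. Qed.

Lemma prev_exponent_ge1 j : (j <= n)%N -> (1 <= prev_exponent p j)%R.
Proof. by case: j => // j jn; exact: p_ge1. Qed.

Lemma le_prev_exponent j : (j < n)%N -> (prev_exponent p j <= p j)%R.
Proof. by case: j => [|j] jn //=; apply: pmono; rewrite leqnSn. Qed.

(** The condition on [indN] selects the points where the estimate can be trusted. It is inherited
    for almost every value of the next coordinate, since the integral of [J j indN] along that
    coordinate is [J j.+1 indN x]. *)
Lemma mn_iter_le_ln_iter j x : (j <= n)%N -> J j indN x = 0 ->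
  (mn_iter p j F x) `^ prev_exponent p j
  <= (m `^ (prev_exponent p j - 1))%:E *
     \esum_(k in lowzero j) (ln_iter p w j A k `^ prev_exponent p j
                             * J j g (zsub (fun i => w * x i)%R k)).
Proof.
elim: j x => [|j IH] x jn hx.
  rewrite /= subrr powRr0 mul1e lowzero0 poweRe1//.
  under eq_esum do rewrite poweRe1//.
  apply: FA => Nx; move: hx; rewrite /= /indN indicE mem_set//.
  by move/eqP; rewrite eqe oner_eq0.
have pj1 := p_ge1 jn; have pj0 : (0 < p j)%R by exact: lt_le_trans pj1.
set P := prev_exponent p j in IH *.
have P1 : (1 <= P)%R by exact: prev_exponent_ge1 (ltnW jn).
have P0 : (0 < P)%R by exact: lt_le_trans P1.
(* The Jensen exponent, at least 1 because the exponents increase. *)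
pose q := (p j / P)%R.
have Pq : (P * q = p j)%R by rewrite /q mulrCA divff ?gt_eqF// mulr1.
have q1 : (1 <= q)%R by rewrite ler_pdivlMr// mul1r; exact: le_prev_exponent.
have q0 : (0 <= q)%R by exact: le_trans q1.
have Jg0 i y : 0 <= J i g y by exact: mn_iter_ge0.
have Aj0 k : 0 <= ln_iter p w j A k by exact: ln_iter_ge0.
have mJ k : measurable_fun [set: R] (fun t : R =>
    J j g (zsub (fun i => w * set_coord x j t i)%R k)).
  apply: (measurableT_comp (measurable_mn_iter1 j g0 mg)).
  by apply: (measurableT_comp (measurable_zsub w k)); exact: measurable_set_coord2.
(* The measurable majorant of the integrand that Jensen's inequality will give. *)
pose K t := (m `^ (p j - 1))%:E * \esum_(k in lowzero j)
  (ln_iter p w j A k `^ p j * J j g (zsub (fun i => w * set_coord x j t i)%R k)).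
have mK' k : measurable_fun [set: R] (fun t => ln_iter p w j A k `^ p j *
    J j g (zsub (fun i => w * set_coord x j t i)%R k)).
  by apply: emeasurable_funM => //; exact: measurable_cst.
have K0' k t : 0 <= ln_iter p w j A k `^ p j *
    J j g (zsub (fun i => w * set_coord x j t i)%R k).
  by rewrite mule_ge0// poweR_ge0.
have c0 : 0 <= (m `^ (p j - 1))%:E by rewrite lee_fin powR_ge0.
have mK : measurable_fun [set: R] K.
  by apply: emeasurable_funM; [exact: measurable_cst|exact: measurable_esum].
have K0 t : 0 <= K t by rewrite mule_ge0//; exact: esum_ge0.
rewrite [prev_exponent _ _]/= [mn_iter _ _ _ _]/= /mn_step poweRVK//; last first.
  by apply: integral_ge0 => t _; exact: poweR_ge0.
apply: (@le_trans _ _ (\int[lebesgue_measure]_t K t)).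
  apply: (@ae_le_lower_integral _ _ _ lebesgue_measure
    (fun t => mn_iter p j F (set_coord x j t) `^ p j) K
    (fun t => J j indN (set_coord x j t))) => //.
  - by move=> t; exact: poweR_ge0.
  - by move=> t; exact: mn_iter_ge0.
  - exact: measurable_mn_iter1_coord.
  - by rewrite -mn_iter1S.
  move=> t /(IH _ (ltnW jn)) {}IH.
  rewrite -[in leLHS]Pq poweRrM.
  apply: le_trans (le_poweR q0 (poweR_ge0 _ _) IH) _.
  rewrite poweRM; first last.
  - by apply: esum_ge0 => k _; rewrite mule_ge0// poweR_ge0.
  - by rewrite lee_fin powR_ge0.
  rewrite poweR_EFin -powRrM.
  (* The induction hypothesis raised to the power q contributes m^((P-1)q), Jensen's inequality
     m^(q-1). *)
  have cK : (m `^ (p j - 1))%:E = (m `^ ((P - 1) * q))%:E * (m `^ (q - 1))%:E.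
    rewrite -EFinM -powRD; last by rewrite (gt_eqF m0) implybT.
    by rewrite mulrBl Pq mul1r addrA subrK.
  rewrite /K cK -muleA; apply: lee_wpmul2l; first by rewrite lee_fin powR_ge0.
  apply: le_trans (jensen_esum q1 m0 _ _ _) _ => //.
  - by move=> k; exact: poweR_ge0.
  - exact: esum_mn_iter1_le (ltnW jn) g0 mg gm.
  by under eq_esum do rewrite -poweRrM Pq.
rewrite ge0_integralZl//; first last.
- by move=> t _; exact: esum_ge0.
- exact: measurable_esum.
apply: lee_wpmul2l => //; rewrite (integral_esum _ measurableT)//.
have -> : \esum_(k in lowzero j) (\int[lebesgue_measure]_t (ln_iter p w j A k `^ p j *
      J j g (zsub (fun i => w * set_coord x j t i)%R k)))
  = \esum_(k in lowzero j) (ln_iter p w j A k `^ p j * ((w^-1)%:E *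
      J j.+1 g (zsub (fun i => w * x i)%R k))).
  apply: eq_esum => k _; rewrite ge0_integralZl// ?poweR_ge0//; last exact: mJ.
  by rewrite (integral_mn_iter1_zsub k (Ordinal jn)).
have wV0 : 0 <= (w^-1)%:E by rewrite lee_fin invr_ge0 ltW.
(* The sum over k_j and the factor 1/w together rebuild the p_j-th power of the lattice norm at
   level j+1. *)
rewrite (esum_lowzeroS (Ordinal jn)); last first.
  by move=> k; rewrite mule_ge0 ?poweR_ge0// mule_ge0.
apply: le_esum => k _.
rewrite [ln_iter _ _ _ _ _]/= /ln_step poweRVK//; last first.
  by rewrite mule_ge0//; apply: esum_ge0 => t _; exact: poweR_ge0.
rewrite muleAC -esumZl//; first last.
- by move=> t; exact: poweR_ge0.
- by rewrite mule_ge0.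
apply: le_esum => t _; rewrite muleC.
(* Coordinate j is already integrated out, so the weight does not depend on the j-th index t. *)
rewrite (@mn_iter_indep _ _ _ j.+1 g _ (zsub (fun i => w * x i)%R k))//.
by move=> i ji; rewrite /zsub ffunE gtn_eqF.
Qed.

End MainEstimate.

(** * Kernel moments, and the sampling lattice *)

Section Kernels.
Context {R : realType} {n : nat}.
Notation pt := ('I_n -> R).
Notation lat := {ffun 'I_n -> int}.
Notation bpt := (g_sigma_algebraType (@boxes R n)).
Local Open Scope ereal_scope.

(** The sums of the positive and negative parts both lie between 0 and the sum of the moduli. If the
    latter is infinite the bound is trivial, whatever [fine] returns. *)
Lemma abs_zsum_le (a : lat -> R) :
  (`|zsum a|)%:E <= \esum_(k in [set: lat]) (`|a k|)%:E.
Proof.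
set E := (leRHS).
have E0 : 0 <= E by apply: esum_ge0 => k _; rewrite lee_fin.
have [->|Ey] := eqVneq E +oo; first exact: leey.
have part (s : R -> R) : (forall r, (0 <= s r <= `|r|)%R) ->
    (0 <= fine (\esum_(k in [set: lat]) (s (a k))%:E) <= fine E)%R.
  move=> hs; have S0 : 0 <= \esum_(k in [set: lat]) (s (a k))%:E.
    by apply: esum_ge0 => k _; rewrite lee_fin; case/andP: (hs (a k)).
  have SE : \esum_(k in [set: lat]) (s (a k))%:E <= E.
    by apply: le_esum => k _; rewrite lee_fin; case/andP: (hs (a k)).
  rewrite fine_ge0//= fine_le// ge0_fin_numE// ?ltey//.
  by rewrite -ltey (le_lt_trans SE)// ltey.
have /andP[x0 xE] := part (fun r => Num.max r 0)%R (fun r => ltac:(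
  by rewrite le_max lexx orbT ge_max ler_norm normr_ge0)).
have /andP[y0 yE] := part (fun r => Num.max (- r) 0)%R (fun r => ltac:(
  by rewrite le_max lexx orbT ge_max ler_normr lexx orbT normr_ge0)).
have Efin : E \is a fin_num by rewrite ge0_fin_numE// ltey.
rewrite -(fineK Efin) lee_fin /zsum ler_norml; apply/andP; split; lra.
Qed.

Lemma measurable_zsum (f : lat -> bpt -> R) :
  (forall k, measurable_fun [set: bpt] (f k)) ->
  measurable_fun [set: bpt] (fun x => zsum (fun k => f k x)).
Proof.
move=> mf; apply: measurable_funB.
- apply: measurableT_comp => //; apply: measurable_esum => [k x|k].
    by rewrite lee_fin le_max lexx orbT.
  apply: measurableT_comp => //; apply: measurable_maxr => //.
- apply: measurableT_comp => //; apply: measurable_esum => [k x|k].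
    by rewrite lee_fin le_max lexx orbT.
  apply: measurableT_comp => //; apply: measurable_maxr => //.
  exact: measurableT_comp.
Qed.

Lemma le_euclid (v : pt) (i : 'I_n) : (`|v i| <= euclid v)%R.
Proof.
rewrite /euclid -sqrtr_sqr ler_sqrt ?sumr_ge0// => [|j _]; last exact: sqr_ge0.
by rewrite (bigD1 i)//= lerDl sumr_ge0// => j _; exact: sqr_ge0.
Qed.

(** If some coordinate of u - k is at least r in modulus, the term is at most r^(-alpha) times the
    term of the alpha-moment. As r <= 1/2, at most one k remains, and there |chi| is bounded by
    M. *)
Lemma moment0_lty (alpha : R) (chi : pt -> R) : (0 <= alpha)%R ->
  is_kernel alpha chi -> moment0 chi < +oo.
Proof.
move=> a0 [_ [r0 [M [r00 hM]]] _ mom].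
pose r := Num.min r0 (2^-1)%R.
have rr0 : (r <= r0)%R by rewrite ge_min lexx.
have r2 : (r <= 2^-1)%R by rewrite ge_min lexx orbT.
have r_gt0 : (0 < r)%R by rewrite lt_min r00 invr_gt0 ltr0n.
have mom0 : 0 <= moment alpha chi.
  apply: le_trans (ereal_sup_ubound _); last by exists (fun=> 0%R).
  by apply: esum_ge0 => k _; rewrite lee_fin mulr_ge0// powR_ge0.
have momfin : moment alpha chi \is a fin_num by rewrite ge0_fin_numE.
pose c := (r `^ alpha)^-1%R.
have c0 : (0 < c)%R by rewrite invr_gt0 powR_gt0.
apply: (@le_lt_trans _ _ (c%:E * moment alpha chi + (`|M|)%:E)); last first.
  by rewrite -(fineK momfin) -EFinM -EFinD ltry.
apply: ge_ereal_sup => _ [u _ <-].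
pose near := [set k : lat | forall i, (`|zsub u k i| < r)%R].
have t0 (k : lat) :
    0 <= c%:E * (`|chi (zsub u k)| * powR (euclid (zsub u k)) alpha)%:E.
  by rewrite -EFinM lee_fin !mulr_ge0 ?powR_ge0// ltW.
apply: (@le_trans _ _ (\esum_(k in [set: lat])
    (c%:E * (`|chi (zsub u k)| * powR (euclid (zsub u k)) alpha)%:E
     + (if k \in near then (`|M|)%:E else 0)))).
  apply: le_esum => k _; case: ifPn; rewrite (inE, notin_setE) => nk.
    rewrite -[leLHS]add0e leeD ?t0// lee_fin.
    apply: le_trans (ler_norm M); apply: hM => i.
    exact: lt_le_trans (nk i) rr0.
  have [i] : exists i, ~ (`|zsub u k i| < r)%R by exact/existsNP.
  move=> /negP; rewrite -leNgt => ri; rewrite adde0 -EFinM lee_fin.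
  rewrite mulrCA ler_peMr// /c mulrC ler_pdivlMr ?powR_gt0// mul1r.
  have re := le_trans ri (le_euclid (zsub u k) i).
  by apply: ge0_ler_powR => //; rewrite nnegrE ?ltW// (lt_le_trans r_gt0).
rewrite esumD; last 2 first.
- by move=> k _; exact: t0.
- by move=> k _; case: ifP.
rewrite esumZl; last 2 first.
- by rewrite lee_fin ltW.
- by move=> k; rewrite lee_fin mulr_ge0 ?powR_ge0.
apply: leeD.
  apply: lee_wpmul2l; first by rewrite lee_fin ltW.
  by apply: ereal_sup_ubound; exists u.
rewrite -esum_mkcond.
have [[k0 nk0]|none] := pselect (exists k, near k); last first.
  by rewrite esum1// => k nk; exfalso; apply: none; exists k.
rewrite (_ : near = [set k0]) ?esum_set1//.
apply/seteqP; split => k /=; last by move=> ->.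
move=> nk; apply/ffunP => i; have := nk i; have := nk0 i.
rewrite /zsub => h0 h; apply/eqP; rewrite -subr_eq0 -normr_le0.
rewrite -(ltzD1 _ 0)// -(ltr_int R) intr_norm rmorphB/= add0r.
by move: h0 h; rewrite !ltr_norml => /andP[? ?] /andP[? ?]; apply/andP; split; lra.
Qed.

(** From the partition of unity at u = 0. This makes m positive, as Jensen's inequality requires. *)
Lemma moment0_ge1 (alpha : R) (chi : pt -> R) : is_kernel alpha chi ->
  1 <= moment0 chi.
Proof.
move=> [_ _ chi1 _].
apply: le_trans (ereal_sup_ubound _); last by exists (fun=> 0%R).
by apply: le_trans (abs_zsum_le _); rewrite chi1 normr1.
Qed.

(** With gap 2/w the cube of k is given by |w x_i - k_i| < 1. The integer parts of the w x_i provide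
    one such k, and every other has each k_i equal to that integer part or one more: at most 2^n
    cubes meet at x. *)
Lemma rel_separated_kdiv (w : R) : (0 < w)%R ->
  rel_separated (fun k : lat => kdiv k w).
Proof.
move=> w0; exists (2 / w)%R; split; first by rewrite divr_gt0.
have -> : (2 / w / 2 = w^-1)%R by field; rewrite gt_eqF.
have cubeP (k : lat) x : cube (kdiv k w) w^-1 x <-> forall i, (`|w * x i - (k i)%:~R| < 1)%R.
  rewrite /cube/= /kdiv; split => h i; have := h i.
    rewrite -(ltr_pM2l w0) divff ?gt_eqF//.
    by rewrite -{1}(gtr0_norm w0) -normrM mulrBr mulrCA divff ?gt_eqF// mulr1.
  rewrite -[ltRHS](@divff _ w) ?gt_eqF// => {}h.
  rewrite -(ltr_pM2l w0) -{1}(gtr0_norm w0) -normrM mulrBr mulrCA divff ?gt_eqF//.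
  by rewrite mulr1 divff ?gt_eqF// in h *.
pose fl (x : pt) : lat := [ffun i => Num.floor (w * x i)%R].
split => [x|].
  apply: esum_ge; exists [set fl x]; first by split.
  rewrite fsbig_set1 indicE mem_set//; apply/cubeP => i; rewrite ffunE.
  have := floor_itv (w * x i)%R; rewrite rmorphD/= => /andP[h1 h2].
  by rewrite ltr_norml; apply/andP; split; lra.
(* This is 2^n, counted by the boolean vectors that say which entries are raised by one. *)
pose C := \esum_(b in [set: {ffun 'I_n -> bool}]) (1%R : R)%:E.
have Cfin : C \is a fin_num.
  have fin : finite_set [set: {ffun 'I_n -> bool}] by exact: finite_finset.
  by rewrite /C esum_fset// fsbig_finite//= sumEFin.
exists (fine C) => x; rewrite fineK//.
pose e (b : {ffun 'I_n -> bool}) : lat := [ffun i => fl x i + (b i : nat)%:Z]%R.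
have einj : set_inj [set: {ffun 'I_n -> bool}] e.
  move=> b b' _ _ /ffunP eb; apply/ffunP => i; have := eb i; rewrite !ffunE.
  by move/addrI; case: (b i) (b' i) => [] [].
apply: (@le_trans _ _ (\esum_(k in range e) (1%R : R)%:E)).
  rewrite [leRHS]esum_mkcond; apply: le_esum => k _.
  rewrite indicE; case: (boolP (x \in _)) => [|_]; last by case: ifP.
  rewrite inE => /cubeP kx; rewrite mem_set//.
  exists [ffun i => k i != fl x i] => //; apply/ffunP => i; rewrite !ffunE.
  have := kx i; have := floor_itv (w * x i)%R.
  set z := (w * x i)%R; set l := Num.floor z; rewrite rmorphD/= ltr_norml.
  move=> /andP[h1 h2] /andP[h3 h4].
  have : ((l - 1)%:~R < ((k i)%:~R : R))%R by rewrite rmorphB/=; lra.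
  have : (((k i)%:~R : R) < (l + 2)%:~R)%R by rewrite rmorphD/=; lra.
  by rewrite !ltr_int; case: eqP => /= [->|]; lia.
by rewrite esum_image.
Qed.

End Kernels.

(** * The norm bound for the sampling operator *)

Unset Implicit Arguments.

Theorem theorem3p4 (R : realType) (n : nat) (w alpha : R) (p : nat -> R)
    (chi f : ('I_n -> R) -> R) :
  (0 < n)%N -> 0 < w -> 1 <= p 0%N ->
  (forall i j : nat, (i <= j < n)%N -> p i <= p j) ->
  0 <= alpha -> is_kernel alpha chi -> Delta p w f ->
  leb_fun (sampling w chi f) /\
  (mixed_norm p (sampling w chi f) < +oo)%E /\
  (mixed_norm p (sampling w chi f) <=
     poweR (moment0 chi) (1 - (p n.-1)^-1) * poweR (l1norm chi) ((p n.-1)^-1)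
     * lnorm p w (fun k => f (kdiv k w)))%E.
Proof.
move=> n0 w0 p1 pmono a0 kchi [_ _ fsum].
have [[lchi chi1] _ _ _] := kchi.
have m_lty := moment0_lty a0 kchi.
have m_ge1 := moment0_ge1 kchi.
have m_fin : moment0 chi \is a fin_num.
  by rewrite ge0_fin_numE// (le_trans _ m_ge1).
set m := fine (moment0 chi).
have mE : moment0 chi = m%:E by rewrite fineK.
have m0 : 0 < m by rewrite -lte_fin -mE (lt_le_trans _ m_ge1).
have [N nN mchi] := leb_funE lchi.
(* The value 0 on [N] keeps |chih| <= |chi| everywhere, so m_0 and the L^1 norm of chi still bound
   those of [chih]. *)
pose chih (x : 'I_n -> R) : R := if x \in N then 0 else chi x.
(* Off this set no w x - k meets [N], so every term of the series is unchanged. *)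
pose wN := \bigcup_(k : {ffun 'I_n -> int}) [set x | N (zsub (fun i => w * x i) k)].
have nwN : null_n wN by apply: null_n_bigcup => k; exact: null_n_zsub.
have chihE x : ~ N x -> chi x = chih x by move=> Nx; rewrite /chih memNset.
have chih_le x : `|chih x| <= `|chi x|.
  by rewrite /chih; case: ifP => // _; rewrite normr0.
have samplE x : ~ wN x -> sampling w chi f x = sampling w chih f x.
  move=> Nx; rewrite /sampling; congr zsum; apply/funext => k.
  by rewrite chihE// => Nk; apply: Nx; exists k.
pose bpt := g_sigma_algebraType (@boxes R n).
have msampl : measurable_fun [set: bpt] (sampling w chih f : bpt -> R).
  apply: measurable_zsum => k; apply: measurable_funM; first exact: measurable_cst.
  exact: (measurableT_comp mchi (measurable_zsub w k)).
split; first exact: leb_fun_ae_eq nwN msampl samplE.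
pose g (x : bpt) : \bar R := (`|chih x|)%:E.
have g0 x : (0 <= g x)%E by rewrite lee_fin.
have mg : measurable_fun [set: bpt] g.
  by do 2 apply: measurableT_comp => //.
have gm v : (\esum_(k in setT) g (zsub v k) <= m%:E)%E.
  rewrite -mE; apply: (le_trans _ (ereal_sup_ubound _)); last by exists v.
  by apply: le_esum => k _; rewrite lee_fin.
pose P := p n.-1.
have P1 : 1 <= P by apply: (le_trans p1); apply: pmono; rewrite /= ltn_predL.
have P0 : 0 < P by exact: lt_le_trans P1.
set G := mixed_norm p _; set L := lnorm p w _.
have G0 : (0 <= G)%E by apply: mn_iter_ge0 => x; rewrite lee_fin.
have L0 : (0 <= L)%E by apply: ln_iter_ge0 => x; rewrite lee_fin.
have l10 : (0 <= l1norm chi)%E by apply: mn_iter_ge0 => x; rewrite lee_fin.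
(* The estimate after all n coordinates, where only the lattice index 0 is left. *)
have key : (G `^ P <= (m `^ (P - 1))%:E * (L `^ P * l1norm chi))%E.
  have := @mn_iter_le_ln_iter R n w p g m wN
    (fun k => (`|f (kdiv k w)|)%:E) (fun x => (`|sampling w chi f x|)%:E)
    w0 p1 pmono g0 mg m0 gm nwN.
  move=> /(_ _ _ _ n (fun=> 0)).
  rewrite (_ : prev_exponent p n = P); last by rewrite /P; case: (n) n0.
  move=> /(_ _ _ _ (leqnn n)) H; apply: (le_trans (H _ _ _ _)) => {H}.
  - by move=> k; rewrite lee_fin.
  - by move=> x; rewrite lee_fin.
  - move=> x Nx; apply: le_trans (abs_zsum_le _) _; apply: le_esum => k _.
    rewrite normrM EFinM chihE// => Nk; apply: Nx; by exists k.
  - by apply/null_nP => //; exact: nwN.1.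
  apply: lee_wpmul2l; first by rewrite lee_fin powR_ge0.
  rewrite lowzeron esum_set1; last first.
    by rewrite mule_ge0 ?poweR_ge0// mn_iter_ge0.
  apply: lee_wpmul2l; first exact: poweR_ge0.
  rewrite (@mn_iter_indep _ _ _ n g _ (fun=> 0)); last first.
    by move=> i; rewrite leqNgt ltn_ord.
  by apply: le_mn_iter1 => // x; rewrite lee_fin.
(* Taking P-th roots turns m^(P-1) into m^(1 - 1/P). *)
have bound : (G <= moment0 chi `^ (1 - P^-1) * l1norm chi `^ P^-1 * L)%E.
  rewrite -[leLHS](poweRe1 G0) -(divff (lt0r_neq0 P0)) poweRrM.
  apply: le_trans (le_poweR _ (poweR_ge0 _ _) key) _; first by rewrite invr_ge0 ltW.
  rewrite poweRM ?mule_ge0 ?poweR_ge0 ?lee_fin ?powR_ge0//.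
  rewrite poweRM ?poweR_ge0// -poweRrM divff ?gt_eqF// poweRe1//.
  rewrite poweR_EFin -powRrM mE poweR_EFin mulrBl divff ?gt_eqF// mul1r.
  by rewrite -muleA [X in (_ * X)%E]muleC.
split => //; apply: (le_lt_trans bound).
have Ly : (L < +oo)%E by apply: fsum; exact: rel_separated_kdiv.
rewrite lte_mul_pinfty ?mule_ge0 ?poweR_ge0//.
by rewrite fin_numM// fin_num_poweR// ge0_fin_numE.
Qed.
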